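(* Let $P,S,T\in\mathbb{C}[[z]]$ have order greater than or equal to $2$, and let $Q_t,U_t,V_t$ be their deformed inversion pairs, respectively. Assume that $P=S+T$ and that $S$ and $T$ are disjoint to each other. Then: (a) $U_t$ and $V_t$ are also disjoint to each other, i.e. for any $\alpha,\beta\in\mathbb{N}^n$, $\langle\nabla D^\alpha U_t(z),\nabla D^\beta V_t(z)\rangle=0$. (b) $Q_t=U_t+V_t$.
   Context: $z=(z_1,\dots,z_n)$ are commuting variables, $D_i=\partial/\partial z_i$, $D^\alpha=D_1^{\alpha_1}\cdots D_n^{\alpha_n}$ for $\alpha\in\mathbb{N}^n$ (with $0\in\mathbb{N}$), $\nabla g=(D_1g,\dots,D_ng)$ (derivatives in $z$ only), and $\langle u,v\rangle=\sum_k u_kv_k$. The order $o(g)$ is the smallest total degree in $z$ of a monomial occurring in $g$ (order $\infty$ for $g=0$). Deformed inversion pair: let $t$ be a formal central parameter. For $P\in\mathbb{C}[[z]]$ with $o(P)\ge2$, the formal map $F_t(z)=z-t\nabla P(z)$ over $\mathbb{C}[[t]]$ has a formal inverse (under composition) of the form $G_t(z)=z+t\nabla Q_t(z)$ for a unique $Q_t(z)\in\mathbb{C}[[t]][[z]]$ with $o(Q_t)\ge2$ (order in $z$); $Q_t$ is called the deformed inversion pair of $P$. Disjointness: for $g\in\mathbb{C}[[z]]$, $\mathcal{A}(g)$ denotes the $\mathbb{C}$-subalgebra of $\mathbb{C}[[z]]$ generated by all partial derivatives $D^\alpha g$, $\alpha\in\mathbb{N}^n$ (including $g$ itself). $S,T\in\mathbb{C}[[z]]$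 are disjoint to each other if $\langle\nabla g_1,\nabla g_2\rangle=0$ for all $g_1\in\mathcal{A}(S)$ and $g_2\in\mathcal{A}(T)$. *)

(* Defs.v *)
From HB Require Import structures.
From mathcomp Require Import all_boot all_order all_algebra.
From mathcomp Require Import boolp reals complex.
From mathcomp Require Import mpoly.

Set Implicit Arguments.
Unset Strict Implicit.
Unset Printing Implicit Defensive.

Import GRing.Theory.
Local Open Scope ring_scope.

(* K[[z_1, .., z_n]]: a formal power series is its family of coefficients,
   indexed by the monomials of the multinomials library. *)
Record fps (n : nat) (K : Type) := Fps { coef_fps :> 'X_{1..n} -> K }.

Lemma fpsP (n : nat) (K : Type) (f g : fps n K) :
  (forall m, f m = g m) -> f = g.
Proof. by case: f g => [f] [g] /= h; congr Fps; apply: funext. Qed.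

HB.instance Definition _ (n : nat) (K : Type) := gen_eqMixin (fps n K).
HB.instance Definition _ (n : nat) (K : Type) := gen_choiceMixin (fps n K).

Section Ring.
Variables (n : nat) (K : comNzRingType).
Implicit Types (f g h : fps n K) (m : 'X_{1..n}).

Definition fps0 : fps n K := Fps (fun=> 0).
Definition fps_opp f := Fps (fun m => - f m).
Definition fps_add f g := Fps (fun m => f m + g m).

Fact fps_addA : associative fps_add.
Proof. by move=> f g h; apply: fpsP => m /=; rewrite addrA. Qed.
Fact fps_addC : commutative fps_add.
Proof. by move=> f g; apply: fpsP => m /=; rewrite addrC. Qed.
Fact fps_add0 : left_id fps0 fps_add.
Proof. by move=> f; apply: fpsP => m /=; rewrite add0r. Qed.
Fact fps_addN : left_inverse fps0 fps_opp fps_add.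
Proof. by move=> f; apply: fpsP => m /=; rewrite addNr. Qed.

HB.instance Definition _ :=
  GRing.isZmodule.Build (fps n K) fps_addA fps_addC fps_add0 fps_addN.

Definition fps1 : fps n K := Fps (fun m => (m == 0%MM)%:R).

(* The bounds on k.1 and k.2 are implied by m = k.1 + k.2 and only make the
   index type finite. *)
Definition fps_mul f g := Fps (fun m =>
  \sum_(k : 'X_{1..n < (mdeg m).+1, (mdeg m).+1} | m == (k.1 + k.2)%MM)
     f k.1 * g k.2).

Definition fps_trunc d f : {mpoly K[n]} :=
  \sum_(k : 'X_{1..n < d}) f k *: 'X_[k].

Lemma mcoeff_fps_trunc d f m :
  (fps_trunc d f)@_m = if (mdeg m < d)%N then f m else 0.
Proof.
rewrite /fps_trunc raddf_sum /=; case: ifP => [lt_m|ge_m].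
  rewrite (bigD1 (BMultinom lt_m)) //= mcoeffZ mcoeffX eqxx mulr1 big1 ?addr0//.
  move=> k neq_k; rewrite mcoeffZ mcoeffX; case: eqP => [km|]; last first.
    by rewrite mulr0.
  by move/eqP: neq_k; case; apply: val_inj.
apply: big1 => k _; rewrite mcoeffZ mcoeffX; case: eqP => [km|]; last first.
  by rewrite mulr0.
by rewrite -km bmdeg in ge_m.
Qed.

Lemma fps_mulE d f g m : (mdeg m < d)%N ->
  fps_mul f g m = (fps_trunc d f * fps_trunc d g)@_m.
Proof.
move=> lt_m; rewrite mcoeffM /=; apply: eq_bigr => -[k1 k2] /= _.
by rewrite !mcoeff_fps_trunc !(leq_trans (bmdeg _)).
Qed.

Lemma fps_trunc_mul d f g m : (mdeg m < d)%N ->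
  (fps_trunc d (fps_mul f g))@_m = (fps_trunc d f * fps_trunc d g)@_m.
Proof. by move=> lt_m; rewrite mcoeff_fps_trunc lt_m (fps_mulE _ _ lt_m). Qed.

Lemma eq_mcoeffM (p p' q q' : {mpoly K[n]}) m :
    (forall k, (mdeg k <= mdeg m)%N -> p@_k = p'@_k) ->
    (forall k, (mdeg k <= mdeg m)%N -> q@_k = q'@_k) ->
  (p * q)@_m = (p' * q')@_m.
Proof.
move=> ep eq; rewrite !mcoeffM; apply: eq_bigr => -[k1 k2] /= _.
by rewrite ep ?eq // -ltnS bmdeg.
Qed.

Fact fps_mulC : commutative fps_mul.
Proof.
by move=> f g; apply: fpsP => m; rewrite !(fps_mulE _ _ (ltnSn _)) mulrC.
Qed.

Fact fps_mulA : associative fps_mul.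
Proof.
move=> f g h; apply: fpsP => m; rewrite !(fps_mulE _ _ (ltnSn _)).
rewrite (@eq_mcoeffM _ (fps_trunc (mdeg m).+1 f) _
  (fps_trunc (mdeg m).+1 g * fps_trunc (mdeg m).+1 h)) //; last first.
  by move=> k le_k; rewrite fps_trunc_mul.
rewrite mulrA; apply: eq_mcoeffM => // k le_k.
by rewrite fps_trunc_mul.
Qed.

Fact fps_mul1 : left_id fps1 fps_mul.
Proof.
move=> f; apply: fpsP => m; rewrite (fps_mulE _ _ (ltnSn _)).
rewrite (@eq_mcoeffM _ 1 _ (fps_trunc (mdeg m).+1 f)) //; last first.
  by move=> k le_k; rewrite mcoeff_fps_trunc ltnS le_k mcoeff1.
by rewrite mul1r mcoeff_fps_trunc ltnSn.
Qed.

Fact fps_mulDl : left_distributive fps_mul fps_add.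
Proof.
move=> f g h; apply: fpsP => m /=; rewrite -big_split /=.
by apply: eq_bigr => k _; rewrite mulrDl.
Qed.

Fact fps1_neq0 : fps1 != 0 :> fps n K.
Proof.
apply/eqP => /(congr1 (fun f : fps n K => f 0%MM)) /= /eqP.
by rewrite eqxx oner_eq0.
Qed.

HB.instance Definition _ := GRing.Zmodule_isComNzRing.Build (fps n K)
  fps_mulA fps_mulC fps_mul1 fps_mulDl fps1_neq0.

Definition fps_scale (c : K) f := Fps (fun m => c * f m).

Fact fps_scaleA a b f : fps_scale a (fps_scale b f) = fps_scale (a * b) f.
Proof. by apply: fpsP => m /=; rewrite mulrA. Qed.
Fact fps_scale1 : left_id 1 fps_scale.
Proof. by move=> f; apply: fpsP => m /=; rewrite mul1r. Qed.
Fact fps_scaleDr : right_distributive fps_scale +%R.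
Proof. by move=> a f g; apply: fpsP => m /=; rewrite mulrDr. Qed.
Fact fps_scaleDl f : {morph fps_scale^~ f : a b / a + b}.
Proof. by move=> a b; apply: fpsP => m /=; rewrite mulrDl. Qed.

HB.instance Definition _ := GRing.Zmodule_isLmodule.Build K (fps n K)
  fps_scaleA fps_scale1 fps_scaleDr fps_scaleDl.

Fact fps_scaleAl (a : K) f g : a *: (f * g) = a *: f * g.
Proof.
apply: fpsP => m /=; rewrite big_distrr /=.
by apply: eq_bigr => k _; rewrite mulrA.
Qed.

HB.instance Definition _ :=
  GRing.Lmodule_isLalgebra.Build K (fps n K) fps_scaleAl.
HB.instance Definition _ := GRing.Lalgebra_isComAlgebra.Build K (fps n K).

End Ring.

Section Theory.
Variables (n : nat) (K : comNzRingType).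
Implicit Types (f g : fps n K) (m : 'X_{1..n}).

Definition fpsX (i : 'I_n) : fps n K := Fps (fun m => (m == U_(i)%MM)%:R).

Definition is_order f (d : nat) : Prop :=
  (exists2 m, f m != 0 & mdeg m = d) /\
  (forall m, f m != 0 -> (d <= mdeg m)%N).

Lemma order_exists f : f <> 0 -> exists d, `[< is_order f d >].
Proof.
move=> f0.
have ex : exists d, `[< exists2 m, f m != 0 & mdeg m = d >].
  apply: contrapT => nex; apply: f0; apply: fpsP => m /=.
  have [//|nz] := eqVneq (f m) 0.
  by case: nex; exists (mdeg m); apply/asboolP; exists m.
case: (ex_minnP ex) => d /asboolP dP dmin.
exists d; apply/asboolP; split=> // m nz.
by apply: dmin; apply/asboolP; exists m.
Qed.

(* None stands for the infinite order of the zero series. *)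
Definition order f : option nat :=
  if pselect (f <> 0) is left f0 then Some (ex_minn (order_exists f0))
  else None.

Definition order_ge (d : nat) f : bool :=
  if order f is Some k then (d <= k)%N else true.

Lemma order_geP d f :
  reflect (forall m, (mdeg m < d)%N -> f m = 0) (order_ge d f).
Proof.
rewrite /order_ge /order; case: pselect => [f0|/contrapT f0].
  case: ex_minnP => k /asboolP ok _.
  apply: (iffP idP) => [le_d m lt_m|h]; case: ok => [[m0 nz0 dm0] kmin].
    have [//|/kmin le_m] := eqVneq (f m) 0.
    by have := leq_trans (leq_ltn_trans le_m lt_m) le_d; rewrite ltnn.
  by rewrite -dm0 leqNgt; apply: contra_neqN nz0; apply: h.
by rewrite f0; apply: (iffP idP).
Qed.

Definition D (i : 'I_n) f : fps n K :=
  Fps (fun m => f (m + U_(i))%MM *+ (m i).+1).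

Definition Dm (a : 'X_{1..n}) f : fps n K :=
  foldr (fun i => iter (a i) (D i)) f (enum 'I_n).

Definition grad f : 'I_n -> fps n K := fun i => D i f.

Definition dot (u v : 'I_n -> fps n K) : fps n K := \sum_(k < n) u k * v k.

(* h belongs to the K-subalgebra generated by all the D^a g, that is to every
   subalgebra containing them. *)
Definition gen_alg g (h : fps n K) : Prop :=
  forall A : {pred fps n K},
    GRing.subalg_closed A -> (forall a, Dm a g \in A) -> h \in A.

Definition disjoint_fps f g : Prop :=
  forall g1 g2, gen_alg f g1 -> gen_alg g g2 -> dot (grad g1) (grad g2) = 0.

(* The composite f(F_1, .., F_n), for F_i without constant term: then F ^ k only
   has monomials of degree at least |k|, so the sum below omits only zero
   terms. *)
Definition fps_comp f (F : 'I_n -> fps n K) : fps n K :=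
  Fps (fun m => \sum_(k : 'X_{1..n < (mdeg m).+1})
                  f k * (\prod_(i < n) F i ^+ k i) m).

Definition inverse_maps (F G : 'I_n -> fps n K) : Prop :=
  (forall i, fps_comp (F i) G = fpsX i) /\
  (forall i, fps_comp (G i) F = fpsX i).

End Theory.

Arguments fpsX {n K} i.

Section Deformation.
Variables (n : nat) (K : comNzRingType).

(* K[[t]][[z]] is fps n (fps 1 K). *)
Definition tvar : fps 1 K := fpsX ord0.

Definition liftt (f : fps n K) : fps n (fps 1 K) := Fps (fun m => (f m)%:A).

Definition deformed_inversion_pair (P : fps n K) (Q : fps n (fps 1 K)) : Prop :=
  order_ge 2 Q /\
  inverse_maps (fun i => fpsX i - tvar *: grad (liftt P) i)
               (fun i => fpsX i + tvar *: grad Q i).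

End Deformation.

(* Main.v *)
(* Inverting F_t gives grad Q = (grad P)(z + t grad Q). Differentiating this in
   t and in z shows that Q solves the Hamilton-Jacobi equation
   2 dQ/dt = <grad Q, grad Q> with Q = P at t = 0. This Cauchy problem has a
   unique solution, and its recursion puts every t-coefficient of Q in the
   algebra generated by the derivatives of P. Hence disjointness of S and T
   passes to U and V coefficientwise; then <grad U, grad V> = 0, so U + V solves
   the problem with initial value S + T = P, and equals Q. *)

Require Import Defs.
From HB Require Import structures.
From mathcomp Require Import all_boot all_order all_algebra.
From mathcomp Require Import boolp reals complex.
From mathcomp Require Import mpoly.

Set Implicit Arguments.
Unset Strict Implicit.

Import GRing.Theory.
Local Open Scope ring_scope.

(** * Coefficients, products and partial derivatives of formal power series *)

Section Coefficients.
Variables (n : nat) (K : comNzRingType).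
Implicit Types (f g : fps n K) (m : 'X_{1..n}) (i j : 'I_n).

Lemma coef_fpsD f g m : (f + g) m = f m + g m.
Proof. by []. Qed.

Lemma coef_fpsN f m : (- f) m = - f m.
Proof. by []. Qed.

Lemma coef_fpsZ c f m : (c *: f) m = c * f m.
Proof. by []. Qed.

Lemma coef_fps1 m : (1 : fps n K) m = (m == 0%MM)%:R.
Proof. by []. Qed.

Lemma coef_fpsM f g m : (f * g) m =
  \sum_(k : 'X_{1..n < (mdeg m).+1, (mdeg m).+1} | m == (k.1 + k.2)%MM)
     f k.1 * g k.2.
Proof. by []. Qed.

Lemma coef_fps_trunc_mul d f g m : (mdeg m < d)%N ->
  (f * g) m = (fps_trunc d f * fps_trunc d g)@_m.
Proof. exact: fps_mulE. Qed.

Lemma coef_fps_sum (I : Type) (r : seq I) (P : pred I) (F : I -> fps n K) m :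
  (\sum_(i <- r | P i) F i) m = \sum_(i <- r | P i) F i m.
Proof. by elim/big_rec2: _ => //= i x y _ <-. Qed.

Lemma coef_fpsMn f k m : (f *+ k) m = f m *+ k.
Proof. by elim: k => [|k IH] //; rewrite !mulrS coef_fpsD IH. Qed.

Lemma coef_fps_trunc d f m : (mdeg m < d)%N -> (fps_trunc d f)@_m = f m.
Proof. by move=> lt; rewrite mcoeff_fps_trunc lt. Qed.

Lemma coef_D i f m : D i f m = f (m + U_(i))%MM *+ (m i).+1.
Proof. by []. Qed.

Lemma D_is_zmod_morphism i : zmod_morphism (@D n K i).
Proof. by move=> f g; apply: fpsP => m /=; rewrite mulrnBl. Qed.

HB.instance Definition _ i :=
  GRing.isZmodMorphism.Build (fps n K) (fps n K) (D i) (D_is_zmod_morphism i).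

Lemma D_scale i c f : D i (c *: f) = c *: D i f.
Proof. by apply: fpsP => m /=; rewrite mulrnAr. Qed.

(** Differentiation lowers degrees by one, so one extra degree has to be kept before it. This
    carries the polynomial product rule over to series. *)
Lemma mderiv_fps_trunc d f i : (fps_trunc d.+1 f)^`M(i) = fps_trunc d (D i f).
Proof.
apply/mpolyP => m; rewrite mcoeff_deriv !mcoeff_fps_trunc.
by rewrite mdegD mdeg1 addn1 ltnS; case: ifP => //; rewrite mul0rn.
Qed.

Lemma DM i f g : D i (f * g) = D i f * g + f * D i g.
Proof.
apply: fpsP => m; rewrite coef_D.
have lt1 : (mdeg m < (mdeg m).+1)%N by [].
have lt2 : (mdeg (m + U_(i)) < (mdeg m).+2)%N by rewrite mdegD mdeg1 addn1.
rewrite (coef_fps_trunc_mul _ _ lt2) -mcoeff_deriv mderivM mcoeffD coef_fpsD.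
rewrite !(coef_fps_trunc_mul _ _ lt1) !mderiv_fps_trunc.
(* The undifferentiated factor is truncated at [(mdeg m).+2] on one side and at [(mdeg m).+1] on the
   other; both agree in degrees up to [mdeg m], the only ones that count at [m]. *)
by congr (_ + _); apply: eq_mcoeffM => // k le_k;
  rewrite !mcoeff_fps_trunc !ltnS le_k (leq_trans le_k).
Qed.

Lemma D_comm i j f : D i (D j f) = D j (D i f).
Proof.
apply: fpsP => m /=; rewrite -!mulrnA -!addmA [(U_(i) + U_(j))%MM]addmC.
congr (_ *+ _); rewrite !mnmDE !mnm1E; have [->|_] := eqVneq i j => //.
by rewrite !addn0 mulnC.
Qed.

Lemma D_fpsX i j : D i (fpsX j : fps n K) = (i == j)%:R.
Proof.
apply: fpsP => m /=.
have -> : ((i == j)%:R : fps n K) m = ((m == 0%MM) && (i == j))%:R.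
  by case: (i == j); rewrite ?andbT ?andbF.
have [->|m0] := eqVneq m 0%MM; first by rewrite mnm0E add0m eq_mnm1 eq_sym.
rewrite [_ == _ :> 'X_{1..n}](_ : _ = false) ?mul0rn //.
apply: contraNF m0 => /eqP /(congr1 (@mdeg n)); rewrite mdegD !mdeg1 addn1.
by case=> /eqP; rewrite mdeg_eq0.
Qed.

Lemma Dm0 f : Dm 0%MM f = f.
Proof. by rewrite /Dm; elim: (enum 'I_n) => //= j s ->; rewrite mnm0E. Qed.

(** [Dm] differentiates in the fixed order of [enum 'I_n], so the extra [D i] is commuted out past
    the variables that precede [i]. *)
Lemma DmS a i f : Dm (a + U_(i)) f = D i (Dm a f).
Proof.
have ns s : i \notin s -> foldr (fun j => iter ((a + U_(i))%MM j) (D j)) f s =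
    foldr (fun j => iter (a j) (D j)) f s.
  elim: s => //= j s IH; rewrite inE negb_or => /andP[nij /IH->].
  by rewrite mnmDE mnm1E (negbTE nij) addn0.
rewrite /Dm; move: (enum_uniq 'I_n) (mem_enum 'I_n i).
rewrite inE; elim: (enum 'I_n) => //= j s IH /andP[js us].
rewrite inE mnmDE mnm1E; have [ij _|nij /= /(IH us)->] := eqVneq i j.
  by rewrite ij addn1 iterS -ij ns // ij.
rewrite addn0; elim: (a j) => //= k ->; exact: D_comm.
Qed.

Lemma coef_fpsXM i f m : (fpsX i * f) (m + U_(i))%MM = f m.
Proof.
rewrite coef_fpsM.
have lt1 : (mdeg U_(i) < (mdeg (m + U_(i))).+1)%N.
  by rewrite mdegD ltnS leq_addl.
have lt2 : (mdeg m < (mdeg (m + U_(i))).+1)%N.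
  by rewrite mdegD ltnS leq_addr.
rewrite (bigD1 (BMultinom lt1, BMultinom lt2)) /=; last by rewrite addmC.
rewrite eqxx mul1r big1 ?addr0 // => -[k1 k2] /= /andP[/eqP e ne].
case: eqP => [k1E|]; last by rewrite mul0r.
case/negP: ne; apply/eqP; congr pair; apply: val_inj => //=.
by apply: (@addmI _ U_(i)%MM); rewrite -{1}k1E -e addmC.
Qed.

Lemma coef_fpsM_low a b f g :
  (forall m, (mdeg m < a)%N -> f m = 0) ->
  (forall m, (mdeg m < b)%N -> g m = 0) ->
  forall m, (mdeg m < a + b)%N -> (f * g) m = 0.
Proof.
move=> fa gb m lt; rewrite coef_fpsM big1 // => -[k1 k2] /= /eqP e.
have [/fa->|le1] := ltnP (mdeg k1) a; first by rewrite mul0r.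
have [/gb->|le2] := ltnP (mdeg k2) b; first by rewrite mulr0.
by move: (leq_add le1 le2); rewrite -mdegD -e leqNgt lt.
Qed.

Lemma eq_coef_fpsM f f' g g' m :
  (forall k, (mdeg k <= mdeg m)%N -> f k = f' k) ->
  (forall k, (mdeg k <= mdeg m)%N -> g k = g' k) -> (f * g) m = (f' * g') m.
Proof.
move=> ef eg; rewrite !coef_fpsM; apply: eq_bigr => -[k1 k2] /= _.
by rewrite ef ?eg // -ltnS bmdeg.
Qed.

(** Every nonconstant coefficient occurs, times a positive integer, in some partial derivative.
    Absence of torsion is assumed in this form so that it applies over both [K] and [K[[t]]]. *)
Lemma D_eq0 f : (forall (x : K) k, x *+ k.+1 = 0 -> x = 0) ->
  (forall i, D i f = 0) -> f 0%MM = 0 -> f = 0.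
Proof.
move=> Kchar Df f0; apply: fpsP => m.
have [i mi|m0] := pickP (fun i => m i != 0%N); last first.
  rewrite (_ : m = 0%MM) //; apply/mnmP => i.
  by rewrite mnm0E; apply/eqP/negbFE/m0.
have /(congr1 (fun g : fps n K => g (m - U_(i))%MM)) /= /Kchar := Df i.
by rewrite submK // lep1mP.
Qed.

End Coefficients.

(** * The chain rule for composition, and differentiation in [t] *)

Lemma derivation_mmap (n : nat) (K A : comNzRingType) (h : {rmorphism K -> A})
    (d : {additive A -> A}) (F : 'I_n -> A) (p : {mpoly K[n]}) :
  (forall x y, d (x * y) = d x * y + x * d y) -> (forall c, d (h c) = 0) ->
  d (mmap h F p) = \sum_i mmap h F p^`M(i) * d (F i).
Proof.
move=> dM dh; pose ok q := d (mmap h F q) = \sum_i mmap h F q^`M(i) * d (F i).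
rewrite -/(ok p).
(* The Leibniz rule for [d] carries the formula over to products; with additivity, it then suffices
   to check constants and variables. *)
have okM q r : ok q -> ok r -> ok (q * r).
  move=> okq okr; rewrite /ok rmorphM /= dM okq okr mulr_suml mulr_sumr.
  rewrite -big_split; apply: eq_bigr => i _ /=.
  by rewrite mderivM rmorphD !rmorphM /= mulrDl mulrAC mulrA.
have okC c : ok c%:MP.
  by rewrite /ok mmapC dh big1 // => i _; rewrite mderivC raddf0 mul0r.
have okX i : ok 'X_i.
  rewrite /ok mmapX mmap1U (bigD1 i) //= mderivX mnm1E eqxx scale1r.
  rewrite -{1}[U_(i)%MM]add0m addmK mpolyX0 rmorph1 mul1r.
  rewrite big1 ?addr0 // => j ne.
  by rewrite mderivX mnm1E eq_sym (negbTE ne) scale0r raddf0 mul0r.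
rewrite [p]mpolyE; apply: (big_ind ok) => [|q r okq okr|m _].
- exact: okC 0.
- rewrite /ok !raddfD /= okq okr -big_split; apply: eq_bigr => i _ /=.
  by rewrite !raddfD /= mulrDl.
rewrite -mul_mpolyC mpolyXE_id; apply: (okM) => //.
apply: (big_ind ok) => [||i _]; [exact: okC 1|exact: okM|].
by elim: (m i) => [|k IH]; rewrite ?exprS; [exact: okC 1|exact: okM].
Qed.

Section TimeParameter.
Variables (n : nat) (K : comNzRingType).
Local Notation A := (fps n (fps 1 K)).
Implicit Types (f g : fps n K) (x y : A) (m : 'X_{1..n}).
Implicit Types (F : 'I_n -> A).

(** Each [F i] has order at least 1, and orders add in products. Hence only finitely many monomials
    contribute to a given coefficient of a composite. *)
Lemma coef_mmap1_low (F : 'I_n -> A) m k :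
  (forall i, F i 0%MM = 0) -> (mdeg m < mdeg k)%N -> mmap1 F k m = 0.
Proof.
move=> F0; rewrite [mdeg k]mdegE /mmap1 => lt_m.
have FX i j m' : (mdeg m' < j)%N -> (F i ^+ j) m' = 0.
  elim: j m' => // j IHj m'; rewrite exprS -(add1n j).
  apply: coef_fpsM_low => // m1.
  by rewrite ltnS leqn0 mdeg_eq0 => /eqP->.
pose low (p : A) a := forall m', (mdeg m' < a)%N -> p m' = 0.
suff: low (\prod_(i < n) F i ^+ k i) (\sum_(i < n) k i)%N by move/(_ m lt_m).
apply: (big_ind2 low) => // [p a q b|i _]; [exact: coef_fpsM_low|exact: FX].
Qed.

(** The embedding of constants is packaged as a ring morphism so that [mmap] can evaluate
    polynomials over [K] at series. *)
Definition lift_const : K -> A :=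
  in_alg (fps n (fps 1 K)) \o in_alg (fps 1 K).

HB.instance Definition _ := GRing.RMorphism.on lift_const.

Lemma lift_constM c x : lift_const c * x = c%:A *: x.
Proof. by rewrite /lift_const /= -scalerAl mul1r. Qed.

(** Composition becomes polynomial evaluation, to which [derivation_mmap] applies. The free bound
    [N] leaves room for the degree that a derivation consumes. *)
Lemma coef_fps_comp_liftt f F N m :
  (forall i, F i 0%MM = 0) -> (mdeg m < N)%N ->
  fps_comp (liftt f) F m = mmap lift_const F (fps_trunc N f) m.
Proof.
move=> F0 lt_m.
have -> : fps_comp (liftt f) F m =
    mmap lift_const F (fps_trunc (mdeg m).+1 f) m.
  rewrite /fps_trunc raddf_sum coef_fps_sum; apply: eq_bigr => k _ /=.
  by rewrite mmapZ mmapX lift_constM coef_fpsZ.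
apply/esym/eqP; rewrite -subr_eq0 -coef_fpsN -coef_fpsD -raddfB; apply/eqP.
rewrite /mmap coef_fps_sum big1_seq // => k /andP[_]; rewrite mcoeff_msupp.
rewrite mcoeffB !mcoeff_fps_trunc lift_constM coef_fpsZ.
have [le_k|lt_k _] := leqP (mdeg k) (mdeg m); last first.
  by rewrite coef_mmap1_low ?mulr0.
by rewrite ltnS le_k (leq_ltn_trans le_k) // subrr eqxx.
Qed.

(** The abstract [d] covers both [dt] and [D j]. The locality hypothesis on [d] is what allows [f]
    to be replaced by a truncation. *)
Lemma derivation_fps_comp (d : {additive A -> A}) f (F : 'I_n -> A) :
  (forall x y, d (x * y) = d x * y + x * d y) ->
  (forall c, d (lift_const c) = 0) ->
  (forall x y m, (forall k, (mdeg k <= (mdeg m).+1)%N -> x k = y k) ->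
     d x m = d y m) ->
  (forall i, F i 0%MM = 0) ->
  d (fps_comp (liftt f) F) = \sum_i fps_comp (liftt (D i f)) F * d (F i).
Proof.
move=> dM dc dlocal F0; apply: fpsP => m.
rewrite (dlocal _ (mmap lift_const F (fps_trunc (mdeg m).+2 f))); last first.
  by move=> k le_k; apply: coef_fps_comp_liftt.
rewrite (derivation_mmap _ _ dM dc) !coef_fps_sum; apply: eq_bigr => i _.
rewrite mderiv_fps_trunc; apply: eq_coef_fpsM => // k le_k.
by rewrite -coef_fps_comp_liftt.
Qed.

Definition dt x : A := Fps (fun m => D ord0 (x m)).

Lemma coef_dt x m : dt x m = D ord0 (x m).
Proof. by []. Qed.

Lemma dt_is_zmod_morphism : zmod_morphism dt.
Proof. by move=> x y; apply: fpsP => m; rewrite coef_dt raddfB. Qed.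

HB.instance Definition _ :=
  GRing.isZmodMorphism.Build A A dt dt_is_zmod_morphism.

Lemma dtM x y : dt (x * y) = dt x * y + x * dt y.
Proof.
apply: fpsP => m; rewrite coef_dt coef_fpsD !coef_fpsM raddf_sum -big_split /=.
by apply: eq_bigr => k _; rewrite DM.
Qed.

Lemma D_one l (L : comNzRingType) (i : 'I_l) : D i (1 : fps l L) = 0.
Proof.
have := DM i (1 : fps l L) 1.
by rewrite !mulr1 mul1r -{1}[D i 1]addr0 => /addrI.
Qed.

Lemma dt_scale c x : dt (c *: x) = D ord0 c *: x + c *: dt x.
Proof. by apply: fpsP => m; rewrite coef_dt coef_fpsZ DM. Qed.

Lemma dt_one : dt 1 = 0.
Proof.
apply: fpsP => m; rewrite coef_dt coef_fps1.
by case: (_ == _); rewrite ?D_one ?raddf0.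
Qed.

Lemma dt_const c : dt (lift_const c) = 0.
Proof.
by rewrite dt_scale dt_one scaler0 addr0 D_scale D_one scaler0 scale0r.
Qed.

Lemma D_const i c : D i (lift_const c) = 0.
Proof. by rewrite D_scale D_one scaler0. Qed.

Lemma dt_D i x : dt (D i x) = D i (dt x).
Proof. by apply: fpsP => m; rewrite coef_D !coef_dt coef_D raddfMn. Qed.

Lemma dt_fps_comp f F : (forall i, F i 0%MM = 0) ->
  dt (fps_comp (liftt f) F) = \sum_i fps_comp (liftt (D i f)) F * dt (F i).
Proof.
apply: derivation_fps_comp; [exact: dtM|exact: dt_const|].
by move=> x y m xy; rewrite !coef_dt xy.
Qed.

Lemma D_fps_comp j f F : (forall i, F i 0%MM = 0) ->
  D j (fps_comp (liftt f) F) = \sum_i fps_comp (liftt (D i f)) F * D j (F i).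
Proof.
apply: derivation_fps_comp; [exact: DM|exact: D_const|].
by move=> x y m xy; rewrite !coef_D xy // mdegD mdeg1 addn1.
Qed.

Lemma D_liftt i f : D i (liftt f) = liftt (D i f).
Proof. by apply: fpsP => m; rewrite coef_D scalerMnl. Qed.

End TimeParameter.

(** * Coefficients in [t], and specialization at [t = 0] *)

Lemma coef0_fpsM (n : nat) (K : comNzRingType) (f g : fps n K) :
  (f * g) 0%MM = f 0%MM * g 0%MM.
Proof.
have lt1 : (mdeg (0%MM : 'X_{1..n}) < 1)%N by rewrite mdeg0.
by rewrite (coef_fps_trunc_mul _ _ lt1) rmorphM /= !coef_fps_trunc.
Qed.

(** The product is the image of the monomial ['X_[k]] under the multiplicative embedding [emb] of
    polynomials into series. *)
Lemma coef_prod_fpsX (n : nat) (K : comNzRingType) (k m : 'X_{1..n}) :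
  (\prod_i (fpsX i : fps n K) ^+ k i) m = (m == k)%:R.
Proof.
pose emb (p : {mpoly K[n]}) := Fps (fun m => p@_m).
have embM : {morph emb : p q / p * q}.
  by move=> p q; apply: fpsP => m'; rewrite coef_fpsM [LHS]mcoeffM.
have emb1 : emb 1 = 1 by apply: fpsP => m'; rewrite [LHS]mcoeff1.
have <- : emb 'X_[k] = \prod_i fpsX i ^+ k i.
  rewrite mpolyXE_id (big_morph emb embM emb1); apply: eq_bigr => i _.
  elim: (k i) => [|j IH]; rewrite ?expr0 // !exprS embM IH; congr (_ * _).
  by apply: fpsP => m'; rewrite [LHS]mcoeffX eq_sym.
by rewrite [LHS]mcoeffX eq_sym.
Qed.

Section TimeCoefficients.
Variables (n : nat) (K : comNzRingType).
Local Notation A := (fps n (fps 1 K)).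
Implicit Types (f g : fps n K) (x y : A) (m : 'X_{1..n}) (e : 'X_{1..1}).
Implicit Types (F : 'I_n -> A).

(** Exchanges the roles of the variables: an element of [K[[t]][[z]]] is read as a series in [t]
    over [K[[z]]]. *)
Definition tcoef e x : fps n K := Fps (fun m => x m e).

Lemma coef_tcoef e x m : tcoef e x m = x m e.
Proof. by []. Qed.

Lemma tcoef_is_zmod_morphism e : zmod_morphism (tcoef e).
Proof. by move=> x y; apply: fpsP. Qed.

HB.instance Definition _ e :=
  GRing.isZmodMorphism.Build A (fps n K) (tcoef e) (tcoef_is_zmod_morphism e).

Lemma tcoef_inj x y : (forall e, tcoef e x = tcoef e y) -> x = y.
Proof.
move=> xy; apply: fpsP => m; apply: fpsP => e.
by rewrite -!coef_tcoef xy.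
Qed.

Lemma tcoefM e x y : tcoef e (x * y) =
  \sum_(k : 'X_{1..1 < (mdeg e).+1, (mdeg e).+1} | e == (k.1 + k.2)%MM)
     tcoef k.1 x * tcoef k.2 y.
Proof.
apply: fpsP => m; rewrite coef_tcoef coef_fpsM !coef_fps_sum.
under eq_bigr do rewrite coef_fpsM.
by rewrite exchange_big; apply: eq_bigr => k _; rewrite coef_fpsM.
Qed.

Lemma tcoefZ e c x : tcoef e (c *: x) =
  \sum_(k : 'X_{1..1 < (mdeg e).+1, (mdeg e).+1} | e == (k.1 + k.2)%MM)
     c k.1 *: tcoef k.2 x.
Proof. by apply: fpsP => m; rewrite coef_tcoef coef_fpsM coef_fps_sum. Qed.

Lemma tcoef1 e : tcoef e 1 = ((e == 0%MM)%:R : K) *: 1.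
Proof.
apply: fpsP => m; rewrite coef_tcoef coef_fps1 coef_fpsZ coef_fps1.
by case: (m == _); rewrite ?mulr1 ?mulr0.
Qed.

Lemma tcoef0M : {morph tcoef 0%MM : x y / x * y}.
Proof.
move=> x y; apply: fpsP => m; rewrite coef_tcoef !coef_fpsM coef_fps_sum.
by apply: eq_bigr => k _; rewrite coef0_fpsM.
Qed.

Lemma tcoef_D e i x : tcoef e (D i x) = D i (tcoef e x).
Proof. by apply: fpsP => m; rewrite coef_tcoef !coef_D coef_fpsMn. Qed.

Lemma tcoef_Dm e a x : tcoef e (Dm a x) = Dm a (tcoef e x).
Proof.
rewrite /Dm; elim: (enum 'I_n) => //= i s <-.
by elim: (a i) => //= j <-; rewrite tcoef_D.
Qed.

Lemma tcoef_dt e x : tcoef e (dt x) = tcoef (e + U_(ord0)) x *+ (e ord0).+1.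
Proof. by apply: fpsP => m; rewrite coef_fpsMn. Qed.

Lemma coef_fps_comp (L : comNzRingType) (f : fps n L) (F : 'I_n -> fps n L) m :
  fps_comp f F m = \sum_(k : 'X_{1..n < (mdeg m).+1})
                      f k * (\prod_(i < n) F i ^+ k i) m.
Proof. by []. Qed.

(** Setting [t = 0] is multiplicative, by [tcoef0M], and turns [F] into the identity map. *)
Lemma tcoef0_fps_comp f F : (forall i, tcoef 0%MM (F i) = fpsX i) ->
  tcoef 0%MM (fps_comp (liftt f) F) = f.
Proof.
move=> F0; apply: fpsP => m; rewrite coef_tcoef coef_fps_comp coef_fps_sum.
have lt_m : (mdeg m < (mdeg m).+1)%N by [].
have XE (k : 'X_{1..n}) : (\prod_i F i ^+ k i) m 0%MM = (m == k)%:R.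
  have t1 : tcoef 0%MM 1 = 1 by rewrite tcoef1 eqxx scale1r.
  rewrite -coef_tcoef (big_morph _ tcoef0M t1) -(coef_prod_fpsX K).
  congr (coef_fps _ m); apply: eq_bigr => i _; rewrite -F0.
  by elim: (k i) => [|j IH]; rewrite ?expr0 // !exprS tcoef0M IH.
rewrite (bigD1 (BMultinom lt_m)) // coef0_fpsM XE eqxx mulr1 coef_fpsZ.
rewrite coef_fps1 eqxx mulr1 big1 => [|k ne]; first exact: addr0.
rewrite coef0_fpsM XE; case: eqP => [mk|]; last by rewrite mulr0.
by case/eqP: ne; apply: val_inj.
Qed.

(** Multiplication by [t] only shifts exponents. This serves to cancel [t] in the inversion
    identity. *)
Lemma tvar_scale_inj : injective ( *:%R (tvar K) : A -> A).
Proof.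
move=> x y xy; apply: fpsP => m; apply: fpsP => e.
have := congr1 (fun z : A => z m (e + U_(ord0))%MM) xy.
by rewrite !coef_fpsZ !coef_fpsXM.
Qed.

(* A t-adic contraction has no fixed point but zero. *)
Lemma tvar_fixpoint_eq0 (H : 'I_n -> 'I_n -> A) (Y : 'I_n -> A) :
  (forall i, Y i = \sum_k H i k * (tvar K *: Y k)) -> forall i, Y i = 0.
Proof.
move=> YE; suff low N i m e : (mdeg e < N)%N -> Y i m e = 0.
  by move=> i; apply: fpsP => m; apply: fpsP => e; apply: low (ltnSn _).
elim: N i m e => // N IH i m e lt_e.
rewrite YE coef_fps_sum coef_fps_sum big1 // => k _.
rewrite coef_fpsM coef_fps_sum big1 // => p _; rewrite coef_fpsZ.
(* Orders in [t]: at least 0 for the entry of [H], and at least [1 + N] for [t Y] by induction. *)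
apply: (@coef_fpsM_low _ _ 0 N.+1) => // e1; rewrite -(add1n N).
apply: coef_fpsM_low => e2; last exact: IH.
rewrite ltnS leqn0 mdeg_eq0 => /eqP->.
by rewrite /= eq_sym mnm1_eq0.
Qed.

End TimeCoefficients.

(** * From the inversion identity to the Hamilton-Jacobi equation *)

Section InversionPair.
Variables (n : nat) (K : comNzRingType).
Local Notation A := (fps n (fps 1 K)).
Variables (P : fps n K) (Q : A).
Hypothesis PQ : deformed_inversion_pair P Q.
Local Notation G := (fun i : 'I_n => fpsX i + tvar K *: grad Q i : A).

Lemma coef_Q_low m : (mdeg m < 2)%N -> Q m = 0.
Proof. by case: PQ => /order_geP + _; apply. Qed.

Lemma coef0_DQ i : (D i Q) 0%MM = 0.
Proof. by rewrite coef_D coef_Q_low ?mul0rn // add0m mdeg1. Qed.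

Lemma coef0_G i : G i 0%MM = 0.
Proof.
rewrite coef_fpsD coef_fpsZ coef0_DQ mulr0 addr0 /=.
by rewrite eq_sym mnm1_eq0.
Qed.

Lemma fps_comp_fpsX i (F : 'I_n -> A) : (forall i, F i 0%MM = 0) -> 
  fps_comp (fpsX i : A) F = F i.
Proof.
move=> F0; apply: fpsP => m.
have -> : fpsX i = liftt (fpsX i : fps n K).
  by apply: fpsP => m' /=; case: eqP => _; rewrite ?scale1r ?scale0r.
(* The bound is at least 2, so the truncation keeps the variable even at [m = 0]. *)
rewrite (@coef_fps_comp_liftt _ _ _ _ (mdeg m).+2) //.
have -> : fps_trunc (mdeg m).+2 (fpsX i : fps n K) = 'X_i; last first.
  by rewrite mmapX mmap1U.
apply/mpolyP => k; rewrite mcoeff_fps_trunc mcoeffX eq_sym /=.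
by have [->|_] := eqVneq k U_(i)%MM; rewrite ?mdeg1 ?if_same.
Qed.

(** The identity [F_t(G_t(z)) = z] reads [z_i + t D_i Q - t (D_i P)(G_t) = z_i]; first [z_i] and
    then [t] cancel. *)
Lemma grad_inversion_pair i : D i Q = fps_comp (liftt (D i P)) G.
Proof.
case: PQ => _ [/(_ i) FG _]; apply: tvar_scale_inj.
have GE : fps_comp (fpsX i - tvar K *: grad (liftt P) i) G =
    fps_comp (fpsX i) G - tvar K *: fps_comp (liftt (D i P)) G.
  apply: fpsP => m; rewrite coef_fpsD coef_fpsN coef_fpsZ.
  rewrite /grad D_liftt /= mulr_sumr -sumrB; apply: eq_bigr => k _.
  by rewrite mulrBl mulrA.
rewrite GE (fps_comp_fpsX i coef0_G) in FG.
by apply: (addrI (fpsX i)); apply/eqP; rewrite -subr_eq FG.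
Qed.

(** At [t = 0] the map [G] is the identity, so [grad_inversion_pair] makes the gradients agree; the
    order conditions take care of the constant term. *)
Lemma tcoef0_inversion_pair :
  (forall (c : K) k, c *+ k.+1 = 0 -> c = 0) -> order_ge 2 P ->
  tcoef 0%MM Q = P.
Proof.
move=> Kchar /order_geP P2; apply/eqP; rewrite -subr_eq0; apply/eqP.
apply: D_eq0 => // [i|]; last first.
  rewrite coef_fpsD coef_fpsN P2 ?mdeg0 // coef_tcoef coef_Q_low ?mdeg0 //.
  exact: subr0.
rewrite raddfB /= -tcoef_D grad_inversion_pair tcoef0_fps_comp ?subrr // => j.
rewrite raddfD /=; have -> : tcoef 0%MM (tvar K *: grad Q j) = 0.
  apply: fpsP => m; rewrite coef_tcoef coef_fpsZ coef0_fpsM /=.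
  by rewrite eq_sym mnm1_eq0 mul0r.
rewrite addr0; apply: fpsP => m /=; case: (m == _) => //.
by rewrite coef_fps1 eqxx.
Qed.

(* With [W = grad Q], differentiating [W = (grad P)(z + t W)] in [t] and in [z]
   shows that [dt W - (jac W) W] is fixed by [t (Hess P)(z + t W)]. *)
Lemma dt_grad_inversion_pair i : dt (D i Q) = \sum_j D j (D i Q) * D j Q.
Proof.
pose Y k := dt (D k Q) - \sum_j D j (D k Q) * D j Q.
suff Y0 : Y i = 0 by apply/eqP; rewrite -subr_eq0; apply/eqP.
apply: (@tvar_fixpoint_eq0 _ _ (fun k l => fps_comp (liftt (D l (D k P))) G)).
move=> {}i; pose H k := fps_comp (liftt (D k (D i P))) G.
have dtE : dt (D i Q) = \sum_k H k * (D k Q + tvar K *: dt (D k Q)).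
  rewrite {1}grad_inversion_pair dt_fps_comp; last exact: coef0_G.
  apply: eq_bigr => k _; congr (_ * _); rewrite raddfD /= dt_scale.
  have -> : dt (fpsX k : A) = 0.
    by apply: fpsP => m /=; case: (m == _); rewrite ?D_one ?raddf0.
  by rewrite D_fpsX eqxx scale1r add0r.
have DE j : D j (D i Q) = \sum_k H k * ((j == k)%:R + tvar K *: D j (D k Q)).
  rewrite {1}grad_inversion_pair D_fps_comp; last exact: coef0_G.
  by apply: eq_bigr => k _; congr (_ * _); rewrite raddfD /= D_scale D_fpsX.
rewrite /Y dtE; under [X in _ - X]eq_bigr do rewrite DE mulr_suml.
rewrite exchange_big -sumrB; apply: eq_bigr => k _ /=.
under eq_bigr do rewrite -mulrA mulrDl.
rewrite -mulr_sumr -mulrBr; congr (_ * _); rewrite big_split /=.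
(* The Kronecker term leaves [D k Q], which cancels the one from [dtE]; what remains is [t Y k]. *)
rewrite (bigD1 k) //= eqxx mul1r big1 ?addr0; last first.
  by move=> j /negbTE->; rewrite mul0r.
rewrite opprD addrACA subrr add0r scalerBr scaler_sumr.
by congr (_ - _); apply: eq_bigr => j _; rewrite scalerAl.
Qed.

(** Both sides vanish at [z = 0], and their gradients agree by [dt_grad_inversion_pair] and the
    symmetry of the Hessian. *)
Lemma dt_inversion_pair :
  (forall (c : K) k, c *+ k.+1 = 0 -> c = 0) ->
  dt Q *+ 2 = dot (grad Q) (grad Q).
Proof.
move=> Kchar; apply/eqP; rewrite -subr_eq0; apply/eqP.
apply: D_eq0 => [c k ck|i|].
- by apply: fpsP => e; apply: (Kchar _ k); rewrite -coef_fpsMn ck.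
- rewrite raddfB raddfMn /= -dt_D dt_grad_inversion_pair raddf_sum /=.
  rewrite -sumrMnl -sumrB big1 // => k _.
  by rewrite DM /grad D_comm [D k Q * _]mulrC mulr2n subrr.
rewrite coef_fpsD coef_fpsN coef_fpsMn coef_dt coef_Q_low ?mdeg0 // raddf0.
rewrite mul0rn coef_fps_sum big1 ?subr0 // => k _.
by rewrite coef0_fpsM coef0_DQ mul0r.
Qed.

End InversionPair.

(** * The algebra generated by the derivatives of a series, and disjointness *)

Section GeneratedAlgebra.
Variables (n : nat) (K : comNzRingType).
Local Notation A := (fps n (fps 1 K)).
Implicit Types (f g h : fps n K) (e : 'X_{1..1}).

Lemma gen_alg_closed g h1 h2 (c : K) : gen_alg g h1 -> gen_alg g h2 ->
  gen_alg g (c *: h1 + h2) /\ gen_alg g (h1 * h2).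
Proof.
move=> g1 g2; split=> B Bc Bg; case: (Bc) => _ BD BM.
  by apply: BD; [exact: g1|exact: g2].
by apply: BM; [exact: g1|exact: g2].
Qed.

Lemma gen_alg1 g : gen_alg g 1.
Proof. by move=> B []. Qed.

Lemma gen_algM g h1 h2 : gen_alg g h1 -> gen_alg g h2 -> gen_alg g (h1 * h2).
Proof. by move=> g1 /(gen_alg_closed 0 g1)[]. Qed.

Lemma gen_algD g h1 h2 : gen_alg g h1 -> gen_alg g h2 -> gen_alg g (h1 + h2).
Proof. by move=> g1 /(gen_alg_closed 1 g1)[]; rewrite scale1r. Qed.

Lemma gen_alg0 g : gen_alg g 0.
Proof.
have [+ _] := gen_alg_closed (-1) (gen_alg1 (g := g)) (gen_alg1 (g := g)).
by rewrite scaleN1r addNr.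
Qed.

Lemma gen_algZ g c h : gen_alg g h -> gen_alg g (c *: h).
Proof.
move=> gh; have [+ _] := gen_alg_closed c gh (gen_alg0 (g := g)).
by rewrite addr0.
Qed.

Lemma gen_alg_sum g (I : Type) (r : seq I) (P : pred I) (F : I -> fps n K) :
  (forall i, gen_alg g (F i)) -> gen_alg g (\sum_(i <- r | P i) F i).
Proof.
by move=> gF; apply: big_ind => // [|h1 h2]; [exact: gen_alg0|exact: gen_algD].
Qed.

Lemma gen_alg_Dm g a : gen_alg g (Dm a g).
Proof. by move=> B _; apply. Qed.

Lemma gen_alg_id g : gen_alg g g.
Proof. by rewrite -{2}[g]Dm0; exact: gen_alg_Dm. Qed.

(** As [gen_alg] quantifies over subalgebras, induction on membership amounts to choosing one: here
    the elements of [gen_alg g] whose [D i] stays in it, closed under products by Leibniz. *)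
Lemma gen_alg_D g i h : gen_alg g h -> gen_alg g (D i h).
Proof.
pose B : {pred fps n K} := [pred h | `[< gen_alg g h /\ gen_alg g (D i h) >]].
suff Bc : GRing.subalg_closed B.
  move=> /(_ B Bc) gB; suff /gB/asboolP[] : forall a, Dm a g \in B by [].
  by move=> a; apply/asboolP; rewrite -DmS; split; exact: gen_alg_Dm.
split.
- apply/asboolP; split; first exact: gen_alg1.
  by rewrite D_one; exact: gen_alg0.
- move=> c h1 h2 /asboolP[g1 Dg1] /asboolP[g2 Dg2]; apply/asboolP.
  by rewrite raddfD /= D_scale; split; apply: gen_algD => //; exact: gen_algZ.
move=> h1 h2 /asboolP[g1 Dg1] /asboolP[g2 Dg2]; apply/asboolP; split.
  exact: gen_algM.
by rewrite DM; apply: gen_algD; exact: gen_algM.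
Qed.

(** The series with all [t]-coefficients in [gen_alg g] form a subalgebra over [K[[t]]], since
    products and scalars act on these coefficients by finite convolutions. *)
Lemma gen_alg_tcoef g (x y : A) :
  (forall e, gen_alg g (tcoef e x)) -> gen_alg x y ->
  forall e, gen_alg g (tcoef e y).
Proof.
move=> gx xy.
pose B : {pred A} := [pred y | `[< forall e, gen_alg g (tcoef e y) >]].
suff Bc : GRing.subalg_closed B.
  apply/asboolP/(xy B Bc) => a; apply/asboolP => e; rewrite tcoef_Dm.
  (* One derivative is peeled off at a time, by induction on the total degree of [a]. *)
  have [k] := ubnP (mdeg a); elim: k a => // k IH a.
  have [i ai|a0 _] := pickP (fun i => a i != 0%N); last first.
    rewrite (_ : a = 0%MM) ?Dm0 //.
    by apply/mnmP => i; rewrite mnm0E; apply/eqP/negbFE/a0.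
  have <- : (a - U_(i) + U_(i))%MM = a by rewrite submK // lep1mP.
  by rewrite mdegD mdeg1 addn1 ltnS DmS => /IH; exact: gen_alg_D.
split.
- by apply/asboolP => e; rewrite tcoef1; apply: gen_algZ; exact: gen_alg1.
- move=> c y1 y2 /asboolP g1 /asboolP g2; apply/asboolP => e.
  rewrite raddfD /= tcoefZ; apply: gen_algD => //.
  by apply: gen_alg_sum => k; exact: gen_algZ.
move=> y1 y2 /asboolP g1 /asboolP g2; apply/asboolP => e.
by rewrite tcoefM; apply: gen_alg_sum => k; exact: gen_algM.
Qed.

Lemma mnm1_succ e : e != 0%MM -> exists e', e = (e' + U_(ord0))%MM.
Proof.
move=> e0; exists (e - U_(ord0))%MM; rewrite submK // lep1mP.
by rewrite -mdeg_eq0 mdegE big_ord1 in e0.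
Qed.

Lemma tcoef_dot e (x y : A) : tcoef e (dot (grad x) (grad y)) =
  \sum_(k : 'X_{1..1 < (mdeg e).+1, (mdeg e).+1} | e == (k.1 + k.2)%MM)
     dot (grad (tcoef k.1 x)) (grad (tcoef k.2 y)).
Proof.
rewrite raddf_sum exchange_big; apply: eq_bigr => i _ /=.
by rewrite tcoefM; apply: eq_bigr => k _; rewrite /grad !tcoef_D.
Qed.

(** Each [t]-coefficient of the pairing is a finite sum of pairings between the algebras of [f] and
    [g], all of which vanish. *)
Lemma disjoint_fps_tcoef f g (x y : A) :
  (forall e, gen_alg f (tcoef e x)) -> (forall e, gen_alg g (tcoef e y)) ->
  disjoint_fps f g -> disjoint_fps x y.
Proof.
move=> fx gy fg x1 y1 /(gen_alg_tcoef fx) fx1 /(gen_alg_tcoef gy) gy1.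
by apply: tcoef_inj => e; rewrite tcoef_dot raddf0 big1 // => k _; exact: fg.
Qed.

End GeneratedAlgebra.

(** * The Cauchy problem for the Hamilton-Jacobi equation *)

Lemma dot_gradD (n : nat) (K : comNzRingType) (f g : fps n K) :
  dot (grad (f + g)) (grad (f + g)) =
  dot (grad f) (grad f) + dot (grad g) (grad g) + dot (grad f) (grad g) *+ 2.
Proof.
rewrite /dot -sumrMnl -!big_split; apply: eq_bigr => i _ /=.
by rewrite /grad raddfD /= -expr2 sqrrD addrAC -!expr2.
Qed.

Section HamiltonJacobi.
Variables (n : nat) (K : numFieldType).
Local Notation A := (fps n (fps 1 K)).
Implicit Types (x y : A) (e : 'X_{1..1}).

Lemma mulrSn_inj_numField (c : K) k : c *+ k.+1 = 0 -> c = 0.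
Proof. by move/eqP; rewrite Num.Theory.mulrn_eq0 => /eqP. Qed.

(* The coefficient form of [dt x = <grad x, grad x> / 2]. *)
Lemma tcoef_succ x e : dt x *+ 2 = dot (grad x) (grad x) ->
  tcoef (e + U_(ord0)) x = ((e ord0).+1 * 2)%:R^-1 *:
    \sum_(k : 'X_{1..1 < (mdeg e).+1, (mdeg e).+1} | e == (k.1 + k.2)%MM)
       dot (grad (tcoef k.1 x)) (grad (tcoef k.2 x)).
Proof.
move=> pde; rewrite -tcoef_dot -pde raddfMn /= tcoef_dt -mulrnA -scaler_nat.
by rewrite scalerA mulVf ?scale1r // Num.Theory.pnatr_eq0.
Qed.

(** By [tcoef_succ] a coefficient of degree [e + 1] in [t] depends only on those of degree at most
    [e], so induction starts from the initial value. *)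
Lemma dt_unique x y : dt x *+ 2 = dot (grad x) (grad x) ->
  dt y *+ 2 = dot (grad y) (grad y) -> tcoef 0%MM x = tcoef 0%MM y -> x = y.
Proof.
move=> pdex pdey xy0; apply: tcoef_inj => e.
have [N] := ubnP (mdeg e); elim: N e => // N IH e.
have [->//|/mnm1_succ[{}e ->]] := eqVneq e 0%MM.
rewrite mdegD mdeg1 addn1 ltnS => lt_e; rewrite !tcoef_succ //.
congr (_ *: _); apply: eq_bigr => -[k1 k2] /= _.
by rewrite !IH // (leq_trans _ lt_e) // bmdeg.
Qed.

(** The recursion [tcoef_succ] uses only scalars, sums, products and derivatives, all of which
    preserve [gen_alg f]. *)
Lemma gen_alg_dt (f : fps n K) x : dt x *+ 2 = dot (grad x) (grad x) ->
  tcoef 0%MM x = f -> forall e, gen_alg f (tcoef e x).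
Proof.
move=> pde x0 e; have [N] := ubnP (mdeg e); elim: N e => // N IH e.
have [-> _|/mnm1_succ[{}e ->]] := eqVneq e 0%MM.
  by rewrite x0; exact: gen_alg_id.
rewrite mdegD mdeg1 addn1 ltnS => lt_e; rewrite tcoef_succ //.
apply: gen_algZ; apply: gen_alg_sum => -[k1 k2]; apply: gen_alg_sum => i.
apply: gen_algM; apply: gen_alg_D; apply: IH;
  by rewrite (leq_trans _ lt_e) ?bmdeg.
Qed.

(** Characteristic zero of the field lets the recursion divide by [2 (e + 1)] and lets a gradient
    determine a series up to its constant term. *)
Lemma inversion_pair_add (P S T : fps n K)
    (Q U V : fps n (fps 1 K)) :
  order_ge 2 P -> order_ge 2 S -> order_ge 2 T ->
  deformed_inversion_pair P Q ->
  deformed_inversion_pair S U ->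
  deformed_inversion_pair T V ->
  P = S + T ->
  disjoint_fps S T ->
  (disjoint_fps U V /\
   forall a b : 'X_{1..n}, dot (grad (Dm a U)) (grad (Dm b V)) = 0) /\
  Q = U + V.
Proof.
move=> P2 S2 T2 PQ SU TV PST ST.
have char0 := mulrSn_inj_numField.
have init (X : fps n K) (Y : fps n (fps 1 K)) :
    deformed_inversion_pair X Y -> order_ge 2 X -> tcoef 0%MM Y = X.
  by move=> XY; apply: (tcoef0_inversion_pair XY char0).
have pde (X : fps n K) (Y : fps n (fps 1 K)) :
    deformed_inversion_pair X Y -> dt Y *+ 2 = dot (grad Y) (grad Y).
  by move=> XY; apply: (dt_inversion_pair XY char0).
have UV : disjoint_fps U V.
  apply: disjoint_fps_tcoef ST.
    exact: gen_alg_dt (pde _ _ SU) (init _ _ SU S2).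
  exact: gen_alg_dt (pde _ _ TV) (init _ _ TV T2).
split; first by split=> // a b; apply: UV; exact: gen_alg_Dm.
apply: dt_unique; first exact: pde PQ.
  (* Disjointness, applied to the generators [U] and [V] themselves, removes the cross term, so the
     quadratic right side is additive here. *)
  have cross : dot (grad U) (grad V) = 0 by apply: UV; exact: gen_alg_id.
  rewrite raddfD mulrnDl /= (pde _ _ SU) (pde _ _ TV).
  by rewrite dot_gradD cross mul0rn addr0.
by rewrite raddfD /= (init _ _ PQ P2) (init _ _ SU S2) (init _ _ TV T2).
Qed.

End HamiltonJacobi.

Theorem theorem2p7 (R : realType) (n : nat) (P S T : fps n R[i])
    (Q U V : fps n (fps 1 R[i])) :
  order_ge 2 P -> order_ge 2 S -> order_ge 2 T ->
  deformed_inversion_pair P Q ->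
  deformed_inversion_pair S U ->
  deformed_inversion_pair T V ->
  P = S + T ->
  disjoint_fps S T ->
  (disjoint_fps U V /\
   forall a b : 'X_{1..n}, dot (grad (Dm a U)) (grad (Dm b V)) = 0) /\
  Q = U + V.
Proof. exact: inversion_pair_add. Qed.
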